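(* Let $k$ be a field, $A$ an associative $k$-algebra, $B$ a commutative $k$-algebra, and $\varepsilon:B\to A$ a morphism of $k$-algebras such that $\varepsilon(B)\subset\mathcal Z(A)$. Suppose that for every $n\ge 1$ we have a $k$-linear map $c_n:A\otimes A\otimes B\to A$. Consider the family of products $\mathcal M=\{m_{\alpha,t}\}_{\alpha\in B}$ on $A[[t]]$ determined by $$m_{\alpha,t}(a\otimes b)=\varepsilon(\alpha)ab+c_1(a\otimes b\otimes\alpha)t+c_2(a\otimes b\otimes\alpha)t^2+c_3(a\otimes b\otimes\alpha)t^3+\cdots\qquad(a,b\in A).$$ (i) The family $\mathcal M$ is associative mod $t^2$ if and only if $c_1\in Z^2((A,B,\varepsilon);A)$. Moreover, the class of $c_1$ in $H^2((A,B,\varepsilon);A)$ is determined by the isomorphism class of $\mathcal M$. (ii) Let $n\ge 1$ and suppose that $\mathcal M$ is associative mod $t^{n+1}$. Then $\mathcal M$ can be extended to a family of products that is associative mod $t^{n+2}$ if and only if $$c_1\overline{\circ}c_n+c_2\overline{\circ}c_{n-1}+\cdots+c_n\overline{\circ}c_1=0\in H^3((A,B,\varepsilon);A).$$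
   Context: All algebras are unital, $\otimes=\otimes_k$, and $\mathcal Z(A)$ is the center of $A$. **Families of products.** The maps $m_{\alpha,t}$ are extended $k[[t]]$-bilinearly (and $t$-adically continuously) from $A$ to $A[[t]]$. The family $\mathcal M$ is associative mod $t^r$ if for all $\alpha,\beta,\gamma\in B$ $$m_{\alpha\beta,t}(\mathrm{id}\otimes m_{\gamma,t})=m_{\beta\gamma,t}(m_{\alpha,t}\otimes \mathrm{id})\quad\text{mod } t^r .$$ Extending a family that is associative mod $t^{n+1}$ (a condition involving only $c_1,\dots,c_n$) to one that is associative mod $t^{n+2}$ means choosing a $k$-linear map $c_{n+1}:A\otimes A\otimes B\to A$ such that the family with coefficients $c_1,\dots,c_n,c_{n+1}$ is associative mod $t^{n+2}$. An isomorphism between two families $\{m^c_{\alpha,t}\}_{\alpha\in B}$ and $\{m^d_{\alpha,t}\}_{\alpha\in B}$ of products on $A[[t]]$ determined, for $a,b\in A$, by $m^c_{\alpha,t}(a\otimes b)=\varepsilon(\alpha)ab+c_1(a\otimes b\otimes\alpha)t+c_2(a\otimes b\otimes\alpha)t^2+\cdots$ and $m^d_{\alpha,t}(a\otimes b)=\varepsilon(\alpha)ab+d_1(a\otimes b\otimes\alpha)t+d_2(a\otimes b\otimes\alpha)t^2+\cdots$ (with the same $A,B,\varepsilon$, and $k$-linear coefficients $c_i$, respectively $d_i$, from $A\otimes A\otimes B$ to $A$) is a $k[[t]]$-linear isomorphism $f:A[[t]]\to A[[t]]$ of the form $f(a)=a+f_1(a)t+f_2(a)t^2+\cdots$ for $a\in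 A$, with $f_i:A\to A$ $k$-linear, such that $m^d_{\alpha,t}(f(a)\otimes f(b))=f(m^c_{\alpha,t}(a\otimes b))$ for all $\alpha\in B$ and $a,b\in A$. The last sentence of (i) means: if two such families, associative mod $t^2$, are isomorphic, then $c_1$ and $d_1$ have the same class in $H^2((A,B,\varepsilon);A)$. **The product $\overline{\circ}$.** For $k$-linear $f,g:A\otimes A\otimes B\to A$, the map $f\overline{\circ}g:A^{\otimes3}\otimes B^{\otimes 3}\to A$ is defined, for $a,b,c\in A$ placed in positions $0,1,2$ and $b_{0,1}=\alpha$, $b_{0,2}=\beta$, $b_{1,2}=\gamma$ in $B$, by $$(f\overline{\circ}g)(a,b,c;\alpha,\beta,\gamma)=f\bigl(g(a\otimes b\otimes\alpha)\otimes c\otimes\beta\gamma\bigr)-f\bigl(a\otimes g(b\otimes c\otimes\gamma)\otimes\alpha\beta\bigr).$$ **Secondary cohomology.** Let $$C^n((A,B,\varepsilon);A)=\mathrm{Hom}_k\bigl(A^{\otimes n}\otimes B^{\otimes\frac{n(n-1)}2},A\bigr).$$ A pure tensor of $A^{\otimes n}\otimes B^{\otimes\frac{n(n-1)}2}$ is written $\bigl((a_i)_{0\le i\le n-1};(b_{u,v})_{0\le u<v\le n-1}\bigr)$; for $n=2$ this is $a_0\otimes a_1\otimes b_{0,1}$. On $x=\bigl((a_i)_{0\le i\le n};(b_{u,v})_{0\le u<v\le n}\bigr)$ the differential $\delta_n^\varepsilon:C^n\to C^{n+1}$ is $$\delta_n^\varepsilon(f)(x)=a_0\,\varepsilon(b_{0,1}\cdots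 b_{0,n})\,f\bigl((a_i)_{1\le i\le n};(b_{u,v})_{1\le u<v\le n}\bigr)+\sum_{i=1}^n(-1)^i f(d_i x)$$ $$\qquad+(-1)^{n+1}\varepsilon(b_{0,n}b_{1,n}\cdots b_{n-1,n})\,f\bigl((a_i)_{0\le i\le n-1};(b_{u,v})_{0\le u<v\le n-1}\bigr)\,a_n ,$$ where in the first term indices are shifted down by one, and $d_ix=\bigl((a'_j);(b'_{u,v})\bigr)$ is given by $a'_j=a_j$ for $j<i-1$, $a'_{i-1}=\varepsilon(b_{i-1,i})a_{i-1}a_i$, $a'_j=a_{j+1}$ for $j\ge i$, and $$b'_{u,v}=\begin{cases} b_{u,v} & u<v<i-1\\ b_{u,i-1}b_{u,i} & u<v=i-1\\ b_{u,v+1} & u<i-1<v\\ b_{i-1,v+1}b_{i,v+1} & u=i-1<v\\ b_{u+1,v+1} & i-1<u<v.\end{cases}$$ These maps satisfy $\delta^\varepsilon_{n+1}\delta^\varepsilon_n=0$. For example $\delta_1^\varepsilon(f)(a_0\otimes a_1\otimes\alpha)=\varepsilon(\alpha)a_0f(a_1)-f(\varepsilon(\alpha)a_0a_1)+\varepsilon(\alpha)f(a_0)a_1$, and, with $b_{0,1}=\alpha$, $b_{0,2}=\beta$, $b_{1,2}=\gamma$, $$\delta_2^\varepsilon(f)(a,b,c;\alpha,\beta,\gamma)=\varepsilon(\alpha\beta)af(b\otimes c\otimes\gamma)-f(\varepsilon(\alpha)ab\otimes c\otimes\beta\gamma)+f(a\otimes\varepsilon(\gamma)bc\otimes\alpha\beta)-\varepsilon(\beta\gamma)f(a\otimes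 b\otimes\alpha)c.$$ Put $Z^n((A,B,\varepsilon);A)=\ker\delta_n^\varepsilon$ and $H^n((A,B,\varepsilon);A)=\ker\delta_n^\varepsilon/\operatorname{im}\delta_{n-1}^\varepsilon$. A cochain being $0$ in $H^n$ means that it lies in $\operatorname{im}\delta_{n-1}^\varepsilon$. *)

(* Defs.v *)
From mathcomp Require Import all_boot all_order all_algebra.

Set Implicit Arguments.
Unset Strict Implicit.
Unset Printing Implicit Defensive.

Import GRing.Theory.
Local Open Scope ring_scope.

Section SecondaryHochschild.

Variables (k : fieldType) (A : algType k) (B : comAlgType k).
Variable eps : {lrmorphism B -> A}.

(* A k-linear map A (x) A (x) B -> A is given by its values on pure tensors,
   i.e. by a k-trilinear map. *)
Definition trilinear (f : A -> A -> B -> A) : Prop :=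
  [/\ forall b beta, linear (fun a => f a b beta),
      forall a beta, linear (fun b => f a b beta)
    & forall a b, linear (fun beta => f a b beta)].

(* The elements of Hom_k (A^(x)n (x) B^(x)(n(n-1)/2), A) are the maps, linear in
   each argument, of the entries a_i (i < n) and b_{u,v} (u < v < n).  The
   entries are read off from families indexed by nat, so that index shifts
   need no casts; [cochain_local] says that no other entry matters. *)
Definition multimap := (nat -> A) -> (nat -> nat -> B) -> A.

Record is_cochain (n : nat) (f : multimap) : Prop := IsCochain {
  cochain_local : forall a a' b b',
    (forall i, (i < n)%N -> a i = a' i) ->
    (forall u v, (u < v < n)%N -> b u v = b' u v) ->
    f a b = f a' b';
  cochain_linearA : forall a b i, (i < n)%N ->
    linear (fun x : A => f (fun j => if j == i then x else a j) b);
  cochain_linearB : forall a b u v, (u < v < n)%N ->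
    linear (fun y : B =>
      f a (fun p q => if (p == u) && (q == v) then y else b p q))
}.

(* [(faceA i a b, faceB i b)] is the pure tensor d_i x; as u < v, a condition
   such as v < i - 1 stands for u < v < i - 1. *)
Definition faceA (i : nat) (a : nat -> A) (b : nat -> nat -> B) : nat -> A :=
  fun j => if (j < i.-1)%N then a j
           else if j == i.-1 then eps (b i.-1 i) * a i.-1 * a i
           else a j.+1.

Definition faceB (i : nat) (b : nat -> nat -> B) : nat -> nat -> B :=
  fun u v => if (v < i.-1)%N then b u v
             else if v == i.-1 then b u i.-1 * b u i
             else if (u < i.-1)%N then b u v.+1
             else if u == i.-1 then b i.-1 v.+1 * b i v.+1
             else b u.+1 v.+1.

(* In the last summand, f only sees the entries of index < n, by
   [cochain_local]. *)
Definition delta (n : nat) (f : multimap) : multimap := fun a b =>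
  a 0%N * eps (\prod_(1 <= j < n.+1) b 0%N j)
    * f (fun i => a i.+1) (fun u v => b u.+1 v.+1)
  + \sum_(1 <= i < n.+1) (-1) ^+ i * f (faceA i a b) (faceB i b)
  + (-1) ^+ n.+1 * (eps (\prod_(0 <= u < n) b u n) * f a b * a n).

Definition is_cocycle (n : nat) (f : multimap) : Prop :=
  is_cochain n f /\ forall a b, delta n f a b = 0.

(* The image of delta_{n-1}, which makes sense for 0 < n. *)
Definition is_coboundary (n : nat) (f : multimap) : Prop :=
  exists g, is_cochain n.-1 g /\ forall a b, f a b = delta n.-1 g a b.

Definition same_class (n : nat) (f g : multimap) : Prop :=
  [/\ is_cocycle n f, is_cocycle n g
    & is_coboundary n (fun a b => f a b - g a b)].

Definition cochain2 (f : A -> A -> B -> A) : multimap :=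
  fun a b => f (a 0%N) (a 1%N) (b 0%N 1%N).

Definition ocirc (f g : A -> A -> B -> A) : multimap := fun a b =>
  f (g (a 0%N) (a 1%N) (b 0%N 1%N)) (a 2%N) (b 0%N 2%N * b 1%N 2%N)
  - f (a 0%N) (g (a 1%N) (a 2%N) (b 1%N 2%N)) (b 0%N 1%N * b 0%N 2%N).

(* A power series over V is its sequence of coefficients, of type nat -> V. *)
Definition constS (a : A) : nat -> A := fun n => if n is 0 then a else 0.

Definition addS (x y : nat -> A) : nat -> A := fun n => x n + y n.

Definition scaleS (p : nat -> k) (x : nat -> A) : nat -> A :=
  fun n => \sum_(i < n.+1) p i *: x (n - i)%N.

(* A family of products is given by the maps c_n, n >= 1; the value c 0 is
   never used, the coefficient of t^0 being eps(alpha) a b. *)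
Definition coef (c : nat -> A -> A -> B -> A) (n : nat) : A -> A -> B -> A :=
  if n is 0 then fun a b alpha => eps alpha * a * b else c n.

(* m_{alpha,t} on A[[t]]: the k[[t]]-bilinear, t-adically continuous extension
   of (a, b) |-> sum_l coef c l a b alpha t^l. *)
Definition prodS (c : nat -> A -> A -> B -> A) (alpha : B)
    (x y : nat -> A) : nat -> A := fun n =>
  \sum_(i < n.+1) \sum_(j < n.+1 | (i + j <= n)%N)
    coef c (n - (i + j)) (x i) (y j) alpha.

Definition assoc_mod (c : nat -> A -> A -> B -> A) (r : nat) : Prop :=
  forall (alpha beta gamma : B) (x y z : nat -> A) (s : nat), (s < r)%N ->
    prodS c (alpha * beta) x (prodS c gamma y z) s
    = prodS c (beta * gamma) (prodS c alpha x y) z s.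

Record is_isomorphism (c d : nat -> A -> A -> B -> A)
    (f : (nat -> A) -> (nat -> A)) : Prop := IsIsomorphism {
  iso_add : forall x y, f (addS x y) =1 addS (f x) (f y);
  iso_scale : forall p x, f (scaleS p x) =1 scaleS p (f x);
  iso_bij : bijective f;
  iso_const0 : forall a, f (constS a) 0%N = a;
  iso_coef_linear : forall i, linear (fun a => f (constS a) i);
  iso_prod : forall alpha a b,
    prodS d alpha (f (constS a)) (f (constS b))
    =1 f (prodS c alpha (constS a) (constS b))
}.

Definition isomorphic (c d : nat -> A -> A -> B -> A) : Prop :=
  exists f, is_isomorphism c d f.

(* The coefficients c_1, ..., c_n, e; the later ones are irrelevant mod
   t^(n+2). *)
Definition extend (c : nat -> A -> A -> B -> A) (n : nat)
    (e : A -> A -> B -> A) : nat -> A -> A -> B -> A := fun i =>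
  if (i <= n)%N then c i else if i == n.+1 then e else fun _ _ _ => 0.

Definition extendable (c : nat -> A -> A -> B -> A) (n : nat) : Prop :=
  exists e, trilinear e /\ assoc_mod (extend c n e) n.+2.

End SecondaryHochschild.

(* Main.v *)
Require Import Defs.
From mathcomp Require Import all_boot all_order all_algebra.
From Stdlib Require Import FunctionalExtensionality.

(** Equating the coefficients of t^(n+1) in the two iterated products of
    constants a, b, e of A, and separating the terms that involve c_{n+1} from
    the others, turns associativity at this order into the single equation

      delta_2(c_{n+1}) = c_1 o c_n + c_2 o c_{n-1} + ... + c_n o c_1

    ([assoc_coef_deltaP]): the first and last summands of each iterated product
    pair c_{n+1} with the undeformed product eps(alpha) a b, and these four
    terms are exactly those of delta_2, while the remaining ones pair c_i with
    c_{n+1-i}.  For n = 0 the right-hand side is empty, so associativity mod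
    t^2 says that c_1 is a cocycle.  For n >= 1 the lower coefficients are
    associative by hypothesis and the right-hand side does not involve c_{n+1},
    so an extension is the same thing as a cochain whose coboundary is the
    obstruction.

    This reasoning sees only constants of A, whereas associativity speaks of
    all power series.  The passage between the two is [assoc_modP], which peels
    off one factor t at a time.

    For the class of c_1, the coefficient of t in the multiplicativity of an
    isomorphism f = id + f_1 t + ... reads c_1 - d_1 = delta_1(f_1)
    ([iso_coef1]). *)

Set Implicit Arguments.
Unset Strict Implicit.
Unset Printing Implicit Defensive.

Import GRing.Theory.
Local Open Scope ring_scope.

Section Products.

(* Otherwise [coef eps c 0 a b alpha] unfolds to the product of A, and the
   lemmas that hold for every coefficient no longer apply to it. *)
Arguments coef : simpl never.

Variables (k : fieldType) (A : algType k) (B : comAlgType k).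
Variable eps : {lrmorphism B -> A}.
Hypothesis eps_central : forall (beta : B) (a : A), eps beta * a = a * eps beta.

Implicit Types (c d : nat -> A -> A -> B -> A) (x y z : nat -> A).

(** * Additivity of the coefficient maps *)

(** The products of power series are sums of values of the coefficient maps,
    so additivity is all that associativity asks of c; k-linearity returns with
    the cochains. *)
Definition biadditive (f : A -> A -> A) : Prop :=
  (forall b, {morph f^~ b : a a' / a + a'})
  /\ (forall a, {morph f a : b b' / b + b'}).

Lemma additive_0 (U V : zmodType) (f : U -> V) :
  {morph f : u v / u + v} -> f 0 = 0.
Proof. by move=> fD; apply: (addrI (f 0)); rewrite -fD !addr0. Qed.

Definition coef_biadditive c : Prop :=
  forall l alpha, biadditive (fun a b => coef eps c l a b alpha).

Lemma coef_biadditiveP c :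
  (forall l, (1 <= l)%N -> trilinear (c l)) -> coef_biadditive c.
Proof.
move=> c_lin [|l] alpha; first by split=> u v w;
  rewrite /coef (mulrDr, mulrDl) ?mulrDl.
have [linl linr _] := c_lin l.+1 isT.
by split=> u v w; [have := linl u alpha 1 v w | have := linr u alpha 1 v w];
  rewrite !scale1r.
Qed.

(** * Products of power series *)

(** Multiplication by t. *)
Definition shiftS x : nat -> A := fun n => if n is m.+1 then x m else 0.

Definition tailS x : nat -> A := fun n => x n.+1.

(** The decomposition x = x_0 + t x'.  It replaces sums over all coefficients
    by an induction on the order. *)
Lemma series_split x : x = addS (constS (x 0%N)) (shiftS (tailS x)).
Proof.
by apply: functional_extensionality => -[|n]; rewrite /addS /= ?addr0 ?add0r.
Qed.

Section Bilinearity.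

Variable c : nat -> A -> A -> B -> A.
Hypothesis cD : coef_biadditive c.

Lemma coef0l l alpha b : coef eps c l 0 b alpha = 0.
Proof. by have [Dl _] := cD l alpha; apply: additive_0 (Dl b). Qed.

Lemma coef0r l alpha a : coef eps c l a 0 alpha = 0.
Proof. by have [_ Dr] := cD l alpha; apply: additive_0 (Dr a). Qed.

Lemma prodSDl alpha x x' y :
  prodS eps c alpha (addS x x') y
  = addS (prodS eps c alpha x y) (prodS eps c alpha x' y).
Proof.
apply: functional_extensionality => n; rewrite /addS /prodS -big_split /=.
apply: eq_bigr => i _; rewrite -big_split; apply: eq_bigr => j _ /=.
by have [Dl _] := cD (n - (i + j))%N alpha; rewrite Dl.
Qed.

Lemma prodSDr alpha x y y' :
  prodS eps c alpha x (addS y y')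
  = addS (prodS eps c alpha x y) (prodS eps c alpha x y').
Proof.
apply: functional_extensionality => n; rewrite /addS /prodS -big_split /=.
apply: eq_bigr => i _; rewrite -big_split; apply: eq_bigr => j _ /=.
by have [_ Dr] := cD (n - (i + j))%N alpha; rewrite Dr.
Qed.

Lemma prodS_shiftl alpha x y :
  prodS eps c alpha (shiftS x) y = shiftS (prodS eps c alpha x y).
Proof.
apply: functional_extensionality => -[|n]; rewrite /prodS /=.
  by rewrite big_ord1; apply: big1 => j _; rewrite coef0l.
rewrite big_ord_recl big1 ?add0r => [|j _]; last by rewrite coef0l.
apply: eq_bigr => i _; rewrite big_mkcond big_ord_recr /= /bump /= add1n.
(* The index j = n + 1 fails the condition i + j <= n. *)
rewrite addSn leqNgt ltnS leq_addl addr0 [RHS]big_mkcond.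
by apply: eq_bigr => j _ /=; rewrite addSn ltnS subSS.
Qed.

Lemma prodS_shiftr alpha x y :
  prodS eps c alpha x (shiftS y) = shiftS (prodS eps c alpha x y).
Proof.
apply: functional_extensionality => -[|n]; rewrite /prodS /=.
  by apply: big1 => i _; apply: big1 => -[[|j] ltj] //= _; rewrite coef0r.
rewrite big_ord_recr /= [X in _ + X]big1 => [|[[|j] ltj] /= lej].
- rewrite addr0; apply: eq_bigr => i _.
  rewrite big_mkcond big_ord_recl /= coef0r if_same add0r [RHS]big_mkcond.
  by apply: eq_bigr => j _; rewrite /bump /= add1n addnS ltnS subSS.
- by rewrite coef0r.
- by move: lej; rewrite addnS ltnS leqNgt ltnS leq_addr.
Qed.

Lemma prodS_constl alpha a y n :
  prodS eps c alpha (constS a) y n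
  = \sum_(j < n.+1) coef eps c (n - j) a (y j) alpha.
Proof.
rewrite /prodS big_ord_recl [X in _ + X]big1 ?addr0 => [|i _]; last first.
  by apply: big1 => j _; rewrite coef0l.
by apply: eq_bigl => j; rewrite add0n -ltnS ltn_ord.
Qed.

Lemma prodS_constr alpha x b n :
  prodS eps c alpha x (constS b) n
  = \sum_(i < n.+1) coef eps c (n - i) (x i) b alpha.
Proof.
apply: eq_bigr => i _; rewrite big_mkcond big_ord_recl big1 /=.
  by rewrite addn0 addr0 -ltnS ltn_ord.
by move=> j _; rewrite coef0r if_same.
Qed.

Lemma prodS_const alpha a b :
  prodS eps c alpha (constS a) (constS b) = fun n => coef eps c n a b alpha.
Proof.
apply: functional_extensionality => n.
rewrite prodS_constl big_ord_recl big1 /= ?subn0 ?addr0 // => i _.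
by rewrite coef0r.
Qed.

End Bilinearity.

(** * Associativity coefficient by coefficient *)

Definition assoc_coef c (m : nat) : Prop :=
  forall (a b e : A) (alpha beta gamma : B),
    \sum_(p < m.+1)
      coef eps c (m - p) a (coef eps c p b e gamma) (alpha * beta)
    = \sum_(p < m.+1)
        coef eps c (m - p) (coef eps c p a b alpha) e (beta * gamma).

(** Both iterated products are additive in each factor and commute with
    multiplication by t.  Writing a factor as a constant plus t times a series,
    the second part contributes to order s what it contributes without t to
    order s - 1, and induction disposes of it; after doing so for the three
    factors only constants remain. *)
Lemma assoc_modP c r :
  coef_biadditive c ->
  assoc_mod eps c r <-> (forall m, (m < r)%N -> assoc_coef c m).
Proof.
move=> cD; split=> [assoc_c m ltmr a b e alpha beta gamma | assoc_c].
  have := assoc_c alpha beta gamma (constS a) (constS b) (constS e) m ltmr.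
  by rewrite !prodS_const // prodS_constl // prodS_constr.
move=> alpha beta gamma x y z s; elim/ltn_ind: s x y z => s IHs x y z ltsr.
have IHshift x' y' z' :
  shiftS (prodS eps c (alpha * beta) x' (prodS eps c gamma y' z')) s
  = shiftS (prodS eps c (beta * gamma) (prodS eps c alpha x' y') z') s.
  by case: s IHs ltsr => //= s IHs ltsr; apply: IHs => //; apply: ltnW.
rewrite [x]series_split !(prodSDl, prodS_shiftl) // /addS.
congr (_ + _); last exact: IHshift.
rewrite [y]series_split !(prodSDl, prodSDr, prodS_shiftl, prodS_shiftr) //.
rewrite /addS.
congr (_ + _); last exact: IHshift.
rewrite [z]series_split !(prodSDr, prodS_shiftr) // /addS.
congr (_ + _); last exact: IHshift.
by rewrite !prodS_const // prodS_constl // prodS_constr //; apply: assoc_c.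
Qed.

(** * The differentials in low degree *)

Lemma delta1E (g : A -> A) a b :
  delta eps 1 (fun a _ => g (a 0%N)) a b
  = eps (b 0%N 1%N) * a 0%N * g (a 1%N) - g (eps (b 0%N 1%N) * a 0%N * a 1%N)
    + eps (b 0%N 1%N) * g (a 0%N) * a 1%N.
Proof.
rewrite /delta !big_nat1 /faceA /= expr1 sqrrN expr1n mul1r mulN1r.
by rewrite -(eps_central _ (a 0%N)).
Qed.

Lemma delta2E (f : A -> A -> B -> A) a b :
  delta eps 2 (cochain2 f) a b
  = eps (b 0%N 1%N * b 0%N 2%N) * a 0%N * f (a 1%N) (a 2%N) (b 1%N 2%N)
    - f (eps (b 0%N 1%N) * a 0%N * a 1%N) (a 2%N) (b 0%N 2%N * b 1%N 2%N)
    + f (a 0%N) (eps (b 1%N 2%N) * a 1%N * a 2%N) (b 0%N 1%N * b 0%N 2%N)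
    - eps (b 0%N 2%N * b 1%N 2%N) * f (a 0%N) (a 1%N) (b 0%N 1%N) * a 2%N.
Proof.
rewrite /delta /cochain2 /faceA /faceB.
rewrite !(big_ltn (m := 0%N)) // !(big_ltn (m := 1%N)) //.
rewrite !(big_ltn (m := 2%N) (n := 3)) //.
rewrite !big_geq // !mulr1 !addr0 /= -(eps_central _ (a 0%N)).
by rewrite expr1 (exprS _ 2) sqrrN expr1n mulr1 !mul1r !mulN1r !addrA.
Qed.

Lemma cochain2P (f : A -> A -> B -> A) :
  trilinear f -> is_cochain 2 (cochain2 f).
Proof.
move=> [lin0 lin1 linB]; split.
- move=> a a' b b' eqa eqb.
  by rewrite /cochain2 (eqa 0%N) // (eqa 1%N) // (eqb 0%N 1%N).
- by move=> a b [|[|i]] // _; [apply: lin0 | apply: lin1].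
- by move=> a b [|u] [|[|v]] // /andP[] // _ _; apply: linB.
Qed.

(** The trilinear map is recovered by evaluating the cochain at families whose
    positions outside its range hold arbitrary values.  Each of the linearity
    conditions on a cochain produces its own such values, and locality
    identifies the results. *)
Lemma trilinear_of_cochain (g : multimap A B) :
  is_cochain 2 g ->
  exists2 f, trilinear f & g = cochain2 f.
Proof.
move=> [g_loc g_linA g_linB].
pose f a b alpha := g (fun i => if i == 0%N then a else b) (fun _ _ => alpha).
exists f; last first.
  apply: functional_extensionality => a; apply: functional_extensionality => b.
  by apply: g_loc => [[|[|i]] //|[|u] [|[|v]] // /andP[]].
split=> [b alpha|a alpha|a b] r u v.
- exact: (g_linA (fun=> b) (fun _ _ => alpha) 0%N).
- have fE w : f a w alpha
      = g (fun i => if i == 1%N then w else a) (fun _ _ => alpha).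
    by apply: g_loc => // -[|[|i]].
  by rewrite !fE; apply: (g_linA (fun=> a) (fun _ _ => alpha) 1%N).
- have fE w : f a b w
      = g (fun i => if i == 0%N then a else b)
          (fun p q => if (p == 0%N) && (q == 1%N) then w else 0).
    by apply: g_loc => // -[|p] [|[|q]] // /andP[].
  by rewrite !fE; apply: (g_linB _ (fun _ _ => 0) 0%N 1%N).
Qed.

(** * Associativity at one order as an equation between cochains *)

(** The terms of index 0 and n + 1 of the two sums involve c_{n+1} and make up
    delta_2(c_{n+1}); the n others are the summands of the obstruction, with
    the opposite sign and in reverse order. *)
Lemma assoc_coef_deltaP c n :
  assoc_coef c n.+1 <->
  (forall a b, delta eps 2 (cochain2 (c n.+1)) a b
     = \sum_(1 <= i < n.+1) ocirc (c i) (c (n.+1 - i)%N) a b).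
Proof.
pose L (a : nat -> A) (b : nat -> nat -> B) p :=
  coef eps c (n.+1 - p) (a 0%N) (coef eps c p (a 1%N) (a 2%N) (b 1%N 2%N))
    (b 0%N 1%N * b 0%N 2%N).
pose R (a : nat -> A) (b : nat -> nat -> B) p :=
  coef eps c (n.+1 - p) (coef eps c p (a 0%N) (a 1%N) (b 0%N 1%N)) (a 2%N)
    (b 0%N 2%N * b 1%N 2%N).
have key a b : \sum_(p < n.+2) L a b p - \sum_(p < n.+2) R a b p
  = delta eps 2 (cochain2 (c n.+1)) a b
    - \sum_(1 <= i < n.+1) ocirc (c i) (c (n.+1 - i)%N) a b.
  have middle : \sum_(1 <= p < n.+1) (L a b p - R a b p)
      = - \sum_(1 <= i < n.+1) ocirc (c i) (c (n.+1 - i)%N) a b.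
    rewrite [in RHS]big_nat_rev -sumrN.
    apply: eq_big_nat => p /andP[p_gt0 ltpn].
    rewrite add1n subSS subKn ?(ltnW ltpn) // opprB /L /R /coef.
    by rewrite subSn //; case: p p_gt0 {ltpn}.
  rewrite -!(big_mkord xpredT) -sumrB big_nat_recr //= big_ltn // middle.
  rewrite delta2E /L /R /coef subn0 subnn.
  rewrite [LHS]addrAC addrA; congr (_ - _ - _).
  by rewrite addrC addrA addrAC.
split=> [assoc_c a b | eq_c a b e alpha beta gamma].
  apply/subr0_eq; rewrite -key; apply/eqP; rewrite subr_eq0; apply/eqP.
  exact: assoc_c.
(* Here b_{0,1} = alpha, b_{0,2} = beta and b_{1,2} = gamma. *)
have := key (nth 0 [:: a; b; e])
  (fun u v => if u is 0 then if v == 1%N then alpha else beta else gamma).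
by rewrite eq_c subrr => /subr0_eq.
Qed.

(** * Coefficients of an isomorphism *)

Lemma scaleS_t x : scaleS (fun i => (i == 1%N)%:R) x = shiftS x.
Proof.
apply: functional_extensionality => -[|n]; rewrite /scaleS.
  by rewrite big_ord1 scale0r.
rewrite 2!big_ord_recl scale0r add0r scale1r subSS subn0.
by rewrite big1 ?addr0 // => i _; rewrite scale0r.
Qed.

(** k[[t]]-linearity enters only through additivity and f (t x) = t f(x), which
    give the low coefficients of f at any series from its values on constants. *)
Lemma iso_series_split c d f x :
  is_isomorphism eps c d f ->
  f x =1 addS (f (constS (x 0%N))) (shiftS (f (tailS x))).
Proof.
move=> iso_f n; rewrite {1}[x]series_split (iso_add iso_f) /addS.
by rewrite -!scaleS_t (iso_scale iso_f).
Qed.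

Lemma iso_coef1 c d f :
  coef_biadditive c -> coef_biadditive d -> is_isomorphism eps c d f ->
  forall a b, cochain2 (c 1%N) a b - cochain2 (d 1%N) a b
    = delta eps 1 (fun a _ => f (constS (a 0%N)) 1%N) a b.
Proof.
move=> cD dD iso_f a b; have f0 x : f x 0%N = x 0%N.
  by rewrite (iso_series_split _ iso_f) /addS addr0 (iso_const0 iso_f).
(* Since f x has the same constant term as x, the coefficient of t in
   f (m^c (a0, a1)) is f_1 (eps alpha a0 a1) + c_1 (a0, a1, alpha). *)
have := iso_prod iso_f (b 0%N 1%N) (a 0%N) (a 1%N) 1%N.
rewrite (iso_series_split _ iso_f) /addS /= f0 !prodS_const // /tailS.
rewrite /prodS big_ord_recl big_ord1.
rewrite big_mkcond [X in _ + X]big_mkcond !big_ord_recl !big_ord0 /=.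
rewrite !f0 !addr0 (delta1E (fun u => f (constS u) 1%N)).
rewrite /coef /bump /cochain2 /= => eq1.
rewrite -[c _ _ _ _](addKr (f (constS (eps (b 0%N 1%N) * a 0%N * a 1%N)) 1%N)).
rewrite -eq1 -addrA [RHS]addrAC [RHS]addrC; congr (_ + _).
by rewrite [LHS]addrC -[in LHS]addrA addKr.
Qed.

(** * Extensions and the obstruction *)

(** At order 0 associativity is that of A, because eps has central values and B
    is commutative. *)
Lemma assoc_coef0 c : assoc_coef c 0.
Proof.
move=> a b e alpha beta gamma; rewrite !big_ord1 /coef /= !rmorphM /= !mulrA.
rewrite -(mulrA _ a (eps gamma)) -(eps_central gamma a) mulrA.
congr (_ * a * b * e).
by rewrite -!rmorphM -mulrA mulrC.
Qed.

Lemma eq_assoc_coef c d m :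
  (forall i, (i <= m)%N -> coef eps c i = coef eps d i) ->
  assoc_coef c m -> assoc_coef d m.
Proof.
move=> eq_cd assoc_c a b e alpha beta gamma.
have := assoc_c a b e alpha beta gamma.
by congr (_ = _); apply: eq_bigr => p _; rewrite !eq_cd ?leq_subr // -ltnS.
Qed.

Lemma assoc_mod2_cocycleP c :
  (forall n, (1 <= n)%N -> trilinear (c n)) ->
  assoc_mod eps c 2 <-> is_cocycle eps 2 (cochain2 (c 1%N)).
Proof.
move=> c_lin; have assocP := assoc_modP 2 (coef_biadditiveP c_lin).
split=> [/assocP assoc_c|[_ c1_closed]].
- split=> [|a b]; first exact/cochain2P/c_lin.
  by have /assoc_coef_deltaP-> := assoc_c 1%N isT; rewrite big_geq.
- apply/assocP => -[|[|m]] // _; first exact: assoc_coef0.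
  by apply/assoc_coef_deltaP => a b; rewrite c1_closed big_geq.
Qed.

(** Up to order n the extended family has the same coefficients as c, hence is
    associative there; at order n + 1 the obstruction is the same for both, as
    it involves only c_1, ..., c_n. *)
Lemma assoc_mod_extendP c n (e : A -> A -> B -> A) :
  (forall i, (1 <= i)%N -> trilinear (c i)) -> trilinear e ->
  assoc_mod eps c n.+1 ->
  assoc_mod eps (extend c n e) n.+2 <->
  (forall a b, delta eps 2 (cochain2 e) a b
     = \sum_(1 <= i < n.+1) ocirc (c i) (c (n.+1 - i)%N) a b).
Proof.
move=> c_lin e_lin.
have ce_lin i : (1 <= i)%N -> trilinear (extend c n e i).
  rewrite /extend => i_gt0; case: leqP => _; first exact: c_lin.
  by case: eqP => // _; split=> * r u v; rewrite scaler0 addr0.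
have extP := assoc_modP n.+2 (coef_biadditiveP ce_lin).
have cP := assoc_modP n.+1 (coef_biadditiveP c_lin).
have ext_c i : (i <= n)%N -> extend c n e i = c i by rewrite /extend => ->.
have ext_e : extend c n e n.+1 = e by rewrite /extend ltnn eqxx.
have eq_sum a b :
  \sum_(1 <= i < n.+1) ocirc (extend c n e i) (extend c n e (n.+1 - i)%N) a b
  = \sum_(1 <= i < n.+1) ocirc (c i) (c (n.+1 - i)%N) a b.
  apply: eq_big_nat => i /andP[i_gt0 lein].
  by rewrite !ext_c // -ltnS ltn_subrL i_gt0.
move=> /cP assoc_c; split=> [/extP assoc_e a b | eq_e].
  have /assoc_coef_deltaP eq_e := assoc_e n.+1 (leqnn _).
  by rewrite -eq_sum -eq_e ext_e.
apply/extP => m; rewrite ltnS leq_eqVlt => /predU1P[-> | ltmn].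
  by apply/assoc_coef_deltaP => a b; rewrite eq_sum ext_e.
apply: eq_assoc_coef (assoc_c m ltmn) => -[|i] // leim.
by rewrite /coef ext_c // -ltnS (leq_ltn_trans leim).
Qed.

End Products.

Theorem theorem3p5 (k : fieldType) (A : algType k) (B : comAlgType k)
    (eps : {lrmorphism B -> A})
    (eps_central : forall (beta : B) (a : A), eps beta * a = a * eps beta)
    (c : nat -> A -> A -> B -> A)
    (c_lin : forall n : nat, (1 <= n)%N -> trilinear (c n)) :
  ((assoc_mod eps c 2 <-> is_cocycle eps 2 (cochain2 (c 1%N)))
   /\ (forall d : nat -> A -> A -> B -> A,
         (forall n : nat, (1 <= n)%N -> trilinear (d n)) ->
         assoc_mod eps c 2 -> assoc_mod eps d 2 ->
         isomorphic eps c d ->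
         same_class eps 2 (cochain2 (c 1%N)) (cochain2 (d 1%N))))
  /\ (forall n : nat, (1 <= n)%N ->
        assoc_mod eps c n.+1 ->
        (extendable eps c n <->
         is_coboundary eps 3 (fun a b =>
           \sum_(1 <= i < n.+1) ocirc (c i) (c (n.+1 - i)%N) a b))).
Proof.
split; first split; first exact: assoc_mod2_cocycleP.
- move=> d d_lin assoc_c assoc_d [f iso_f].
  split; [exact/assoc_mod2_cocycleP | exact/assoc_mod2_cocycleP|].
  exists (fun a _ => f (constS (a 0%N)) 1%N); split; last first.
    by apply: iso_coef1 iso_f => //; apply: coef_biadditiveP.
  split.
  + by move=> a a' _ _ eqa _; rewrite eqa.
  + by move=> a b [|i] // _; apply: (iso_coef_linear iso_f 1%N).
  + by move=> a b u [|v] // /andP[].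
- move=> n _ assoc_c.
  split=> [[e [e_lin]]|[g [/trilinear_of_cochain[e e_lin ->] eq_e]]].
    move/(assoc_mod_extendP eps_central c_lin e_lin assoc_c) => eq_e.
    exists (cochain2 e); split; first exact: cochain2P.
    by move=> a b; rewrite eq_e.
  by exists e; split=> //; apply/assoc_mod_extendP.
Qed.
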